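(* Let $M$ be a matroid and $(F,H)$ a non-modular pair of disjoint flats of $M$, where $H$ is a hyperplane of $M$. Then there exists an extension $N$ of $M$ such that for every extension $N'$ of $N$, the pair $(\operatorname{cl}_{N'}(F),\operatorname{cl}_{N'}(H))$ is not a modular pair in $N'$.
   Context: A pair $(X,Y)$ of subsets is modular if $\operatorname{rk}(X)+\operatorname{rk}(Y)=\operatorname{rk}(X\cup Y)+\operatorname{rk}(X\cap Y)$. An extension of a matroid $M$ on $E$ is a matroid $N$ on $F\supseteq E$ with $N|E=M$. *)

(* Defs.v *)
From mathcomp Require Import all_boot.

Set Implicit Arguments.
Unset Strict Implicit.
Unset Printing Implicit Defensive.

(* Finite matroids, given by their rank function; the ground set is the whole
   finite type [E]. *)
Record matroid (E : finType) := Matroid {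
  rk : {set E} -> nat;
  rk_le_card : forall X : {set E}, rk X <= #|X|;
  rk_mono : forall X Y : {set E}, X \subset Y -> rk X <= rk Y;
  rk_submod : forall X Y : {set E}, rk (X :|: Y) + rk (X :&: Y) <= rk X + rk Y
}.

Section Notions.
Variables (E : finType) (M : matroid E).

Definition cl (X : {set E}) : {set E} :=
  [set e | rk M (e |: X) == rk M X].

Definition flat (X : {set E}) : bool := cl X == X.

Definition hyperplane (X : {set E}) : bool :=
  flat X && ((rk M X).+1 == rk M [set: E]).

Definition modular_pair (X Y : {set E}) : Prop :=
  rk M X + rk M Y = rk M (X :|: Y) + rk M (X :&: Y).

End Notions.

(* The inclusion of ground sets E \subset E' is an injection [i : E -> E'], and
   the restriction of [N] to E is the rank function of [N] on subsets of the
   image of [i].  The rank of [N] may exceed that of [M]. *)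
Definition extension (E E' : finType) (M : matroid E) (N : matroid E')
    (i : E -> E') : Prop :=
  injective i /\ forall X : {set E}, rk N (i @: X) = rk M X.

(* Main.v *)
Require Import Defs.
From mathcomp Require Import all_boot zify.
From Stdlib Require Import Classical.

Set Implicit Arguments.
Unset Strict Implicit.
Unset Printing Implicit Defensive.

(* If no extension makes the closures of [F] and [H] a modular pair, [M] itself
   serves as [N].  Otherwise some extension [M1] contains a flat [L] of rank
   [rk F - 1] in both closures, with basis [p |: C].  Adjoin to [M1] a set [D]
   of [rk M - 1 - rk F] generic points of [H] and two pairs [A = {a, a'}],
   [B = {b, b'}] that raise the rank by one in total, placed so that [p] lies
   in the closures of both [A :|: C :|: D] and [B].  After the deletion of [p],
   [W = A :|: B :|: C :|: D] is a circuit-hyperplane, and relaxing it gives [N],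
   a higher-rank analogue of the Vamos matroid: a flat of rank [rk F - 1] in
   both closures in an extension of [N] would force [W] to be dependent. *)

(** * Closure, independence and bases from the rank axioms *)

Section MatroidTheory.
Variables (E : finType) (M : matroid E).
Implicit Types X Y Z : {set E}.

Lemma rk0 : rk M set0 = 0.
Proof. by have := rk_le_card M set0; rewrite cards0; lia. Qed.

Lemma rkU_le X Y : rk M (X :|: Y) <= rk M X + #|Y|.
Proof. by have := rk_submod M X Y; have := rk_le_card M Y; lia. Qed.

(** By submodularity, an element that does not raise the rank of [X] does not raise that of a larger
    set; the elements of [Z] are added one at a time. *)
Lemma rk_cl_sub X Y : X \subset Y -> Y \subset cl M X -> rk M Y = rk M X.
Proof.
move=> sXY sYc; apply/eqP; rewrite eqn_leq (rk_mono M sXY) andbT.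
have: forall n Z, #|Z| = n -> Z \subset cl M X -> rk M (X :|: Z) <= rk M X.
  elim=> [|n IHn] Z cardZ sZ; first by rewrite (cards0_eq cardZ) setU0.
  have /card_gt0P[z zZ] : 0 < #|Z| by rewrite cardZ.
  have cardZ' : #|Z :\ z| = n by have := cardsD1 z Z; rewrite zZ cardZ; lia.
  have := IHn _ cardZ' (subset_trans (subsetDl _ _) sZ).
  have := subsetP sZ z zZ; rewrite inE => /eqP.
  have := rk_submod M (z |: X) (X :|: Z :\ z).
  have -> : (z |: X) :|: (X :|: Z :\ z) = X :|: Z.
    by apply/setP => x; rewrite !inE; case: eqP => [->|_]; rewrite ?zZ ?orbT //= orbA orbb.
  have /(rk_mono M) : X \subset (z |: X) :&: (X :|: Z :\ z).
    by rewrite subsetI subsetUl subsetUr.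
  by lia.
by move=> /(_ _ Y erefl sYc); rewrite (setUidPr sXY).
Qed.

Lemma sub_cl X : X \subset cl M X.
Proof. by apply/subsetP => x xX; rewrite inE (setUidPr _) // sub1set. Qed.

Lemma rk_cl X : rk M (cl M X) = rk M X.
Proof. exact: rk_cl_sub (sub_cl X) _. Qed.

Lemma sub_clE X Y : (Y \subset cl M X) = (rk M (X :|: Y) <= rk M X).
Proof.
apply/idP/idP => [sY | leY].
  by rewrite (@rk_cl_sub X) ?subsetUl // subUset sub_cl.
apply/subsetP => y yY; rewrite inE eqn_leq (rk_mono M (subsetUr _ _)) andbT.
apply: leq_trans leY; apply: rk_mono.
by rewrite subUset subsetUl sub1set inE yY orbT.
Qed.

Lemma cl_min X Y : X \subset cl M Y -> cl M X \subset cl M Y.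
Proof.
move=> sXY; rewrite sub_clE.
have := rk_submod M (cl M Y) (cl M X).
have /(rk_mono M) : X \subset cl M Y :&: cl M X by rewrite subsetI sXY sub_cl.
have /(rk_mono M) := setSU (cl M X) (sub_cl Y).
by rewrite !rk_cl; lia.
Qed.

Lemma rk_clU X Y : rk M (cl M X :|: Y) = rk M (X :|: Y).
Proof.
apply: rk_cl_sub; first exact: setSU (sub_cl X).
rewrite subUset cl_min ?(subset_trans (subsetUr X Y)) ?sub_cl //.
exact: subset_trans (subsetUl _ _) (sub_cl _).
Qed.

Lemma rk_clUcl X Y : rk M (cl M X :|: cl M Y) = rk M (X :|: Y).
Proof. by rewrite rk_clU setUC rk_clU setUC. Qed.

(** Independence is written [#|X| <= rk M X], the reverse bound being an axiom. The elements of [Y]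
    outside [X] raise the rank by at most their number. *)
Lemma indep_sub X Y : X \subset Y -> #|Y| <= rk M Y -> #|X| <= rk M X.
Proof.
move=> sXY; have := rkU_le X (Y :\: X); have := cardsID X Y.
by rewrite setDE setUIr setUCr setIT (setUidPr sXY) -setDE (setIidPr sXY); lia.
Qed.

Lemma exists_basis X :
  exists2 B : {set E}, B \subset X & #|B| = rk M X /\ rk M B = rk M X.
Proof.
have: exists B : {set E}, (B \subset X) && (#|B| <= rk M B).
  by exists set0; rewrite sub0set cards0.
case/ex_maxset => B /maxsetP[/andP[sBX indB] maxB].
have rkB : rk M X = rk M B.
  apply: rk_cl_sub => //; apply/subsetP => x xX; rewrite inE.
  apply: contraT => nx.
  have xB : x \notin B.
    by apply: contra nx => xB; rewrite (setUidPr _) // sub1set.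
  have := maxB (x |: B); rewrite subUset sub1set xX sBX cardsU1 xB andbT /=.
  have ltx : rk M B < rk M (x |: B).
    by rewrite ltn_neqAle eq_sym nx rk_mono ?subsetUr.
  move=> /(_ (leq_ltn_trans indB ltx) (subsetUr _ _)) eqB.
  by move: xB; rewrite -eqB !inE eqxx.
by exists B => //; split=> //; have := rk_le_card M B; lia.
Qed.

End MatroidTheory.

(** * The obstruction to modular closures *)

(* [F] and [H] have joint rank [r] and connectivity [rk F - 1]; [D] is free
   over [F].  If the closures of [F] and [H] met in a set [L] of rank
   [rk F - 1], then [L] would lie in the closures of both [D :|: A] and
   [D :|: B], which are forced apart by the last hypothesis. *)
Lemma not_modular_cl (E : finType) (M : matroid E)
    (F H C D A B : {set E}) (d r : nat) :
  rk M F + d + 1 = r -> rk M H + 1 = r -> rk M (F :|: H) <= r ->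
  rk M (F :|: C) <= rk M F -> rk M (H :|: C) <= rk M H ->
  rk M F + d <= rk M (F :|: D) ->
  rk M (F :|: (D :|: A)) <= r -> rk M (H :|: (D :|: A)) <= r ->
  r < rk M ((F :|: H) :|: A) ->
  rk M (F :|: (D :|: B)) <= r -> rk M (H :|: (D :|: B)) <= r ->
  r < rk M ((F :|: H) :|: B) ->
  r < rk M (C :|: D :|: (A :|: B)) ->
  ~ modular_pair M (cl M F) (cl M H).
Proof.
move=> rF rH rFH; rewrite -!sub_clE => CF CH rFD.
move=> rFA rHA rA rFB rHB rB rW; rewrite /modular_pair.
set L := cl M F :&: cl M H; rewrite rk_clUcl !rk_cl => modL.
(* [D] raises the rank of the larger set [cl M F] by at least [d], hence that of [L] too. *)
have rLD : rk M L + d <= rk M (L :|: D).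
  have := rk_submod M (cl M F) (L :|: D).
  have -> : cl M F :|: (L :|: D) = cl M F :|: D.
    by rewrite setUA (setUidPl (subsetIl _ _)).
  have /(rk_mono M) : L \subset cl M F :&: (L :|: D).
    by rewrite subsetI subsetIl subsetUl.
  by rewrite rk_clU rk_cl; lia.
(* Joined with [D :|: A'], each closure has rank at most [r], but their union has more; so less than
   [r] is left for the intersection, which contains [L :|: D :|: A']. *)
have rL A' : rk M (F :|: (D :|: A')) <= r -> rk M (H :|: (D :|: A')) <= r ->
    r < rk M ((F :|: H) :|: A') -> rk M (L :|: D :|: A') < r.
  move=> r1 r2 r3; have := rk_submod M (cl M F :|: (D :|: A')) (cl M H :|: (D :|: A')).
  rewrite -setUIl -setUUl -/L [L :|: (D :|: A')]setUA.
  have /(rk_mono M) : (F :|: H) :|: A' \subset (cl M F :|: cl M H) :|: (D :|: A').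
    by rewrite setUSS ?setUSS ?sub_cl ?subsetUr.
  by rewrite !rk_clU; lia.
(* Modularity gives [L] rank at least [rk F - 1], hence [L :|: D] rank at least [r - 2]. Two sets of
   rank at most [r - 1] that share it have a union of rank at most [r]. *)
have := rk_submod M (L :|: D :|: A) (L :|: D :|: B).
have /(rk_mono M) : L :|: D \subset (L :|: D :|: A) :&: (L :|: D :|: B).
  by rewrite subsetI !subsetUl.
have /(rk_mono M) : C :|: D :|: (A :|: B) \subset (L :|: D :|: A) :|: (L :|: D :|: B).
  by rewrite -setUUr !setSU // subsetI CF CH.
by have := rL A rFA rHA rA; have := rL B rFB rHB rB; lia.
Qed.

(** * Principal extensions *)

(* The elements of [D] become generic elements of the closure of [K], subject
   to raising the rank of [K] by at most [c]; whatever [M] says about [D] is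
   overridden. *)
Section PrincipalExtension.
Variables (E : finType) (M : matroid E) (K : {set E}) (c : nat) (D : {set E}).
Implicit Types X Y S : {set E}.

Definition prext_free X := rk M (X :\: D) + #|X :&: D|.
Definition prext_cap X := rk M (X :\: D :|: K) + c.
(** For [K] disjoint from [D] and [c = 0], this is the usual principal extension of the deletion of
    [D]; a positive [c] amounts to first joining [c] coloops to [K]. *)
Definition prext_rk X := minn (prext_free X) (prext_cap X).

Lemma prext_free_submod X Y :
  prext_free (X :|: Y) + prext_free (X :&: Y) <= prext_free X + prext_free Y.
Proof.
rewrite /prext_free; have := rk_submod M (X :\: D) (Y :\: D).
by have := cardsUI (X :&: D) (Y :&: D); rewrite -setDUl -setDIl -setIUl -setIIl; lia.
Qed.

Lemma prext_cap_submod X Y :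
  prext_cap (X :|: Y) + prext_cap (X :&: Y) <= prext_cap X + prext_cap Y.
Proof.
rewrite /prext_cap; have := rk_submod M (X :\: D :|: K) (Y :\: D :|: K).
by rewrite -setUUl -setUIl -setDUl -setDIl; lia.
Qed.

(** Outside [D], enlarging [X] gains no more rank in the presence of [K] than without it, so the
    difference [prext_cap - prext_free] is antitone. *)
Lemma prext_gap X Y : X \subset Y ->
  prext_cap Y + prext_free X <= prext_cap X + prext_free Y.
Proof.
move=> sXY; rewrite /prext_cap /prext_free.
have := rk_submod M (X :\: D :|: K) (Y :\: D).
have /(rk_mono M) : X :\: D \subset (X :\: D :|: K) :&: (Y :\: D).
  by rewrite subsetI subsetUl setSD.
rewrite setUAC (setUidPr (setSD D sXY)).
by have := subset_leq_card (setSI D sXY); lia.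
Qed.

Lemma prext_le_card X : prext_rk X <= #|X|.
Proof.
rewrite /prext_rk /prext_free; have := rk_le_card M (X :\: D).
by have := cardsID D X; lia.
Qed.

Lemma prext_mono X Y : X \subset Y -> prext_rk X <= prext_rk Y.
Proof.
move=> sXY; rewrite /prext_rk /prext_free /prext_cap.
have := subset_leq_card (setSI D sXY); have := rk_mono M (setSD D sXY).
by have := rk_mono M (setSU K (setSD D sXY)); lia.
Qed.

(** The minimum of two submodular functions with antitone difference is submodular: in the mixed
    case, [prext_gap] yields the bound with [prext_cap] of the union and [prext_free] of the
    intersection. *)
Lemma prext_submod X Y :
  prext_rk (X :|: Y) + prext_rk (X :&: Y) <= prext_rk X + prext_rk Y.
Proof.
rewrite /prext_rk; have := prext_free_submod X Y; have := prext_cap_submod X Y.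
by have := prext_gap (subsetUl X Y); have := prext_gap (subsetUr X Y); lia.
Qed.

Definition prext := Matroid prext_le_card prext_mono prext_submod.

Lemma prext_ge X Y S n : Y :|: S \subset X -> Y \subset ~: D -> S \subset D ->
  n <= rk M Y + #|S| -> n <= rk M (Y :|: K) + c -> n <= rk prext X.
Proof.
rewrite subUset => /andP[sYX sSX] sYD sSD.
have sY : Y \subset X :\: D by rewrite setDE subsetI sYX.
have /subset_leq_card : S \subset X :&: D by rewrite subsetI sSX.
move: (rk_mono M sY) (rk_mono M (setSU K sY)).
by rewrite /= /prext_rk /prext_free /prext_cap; lia.
Qed.

Lemma prext_le_free X Y S : X :\: D \subset Y -> X :&: D \subset S ->
  rk prext X <= rk M Y + #|S|.
Proof.
move=> /(rk_mono M) leY /subset_leq_card leS.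
by rewrite /= /prext_rk /prext_free; lia.
Qed.

Lemma prext_le_cap X Y : X :\: D :|: K \subset Y -> rk prext X <= rk M Y + c.
Proof. by move=> /(rk_mono M); rewrite /= /prext_rk /prext_cap; lia. Qed.

Lemma prext_old X : X \subset ~: D -> rk prext X = rk M X.
Proof.
move=> sXD.
have XD0 : X :&: D = set0 by apply/eqP; rewrite setI_eq0 disjoints_subset.
apply/eqP; rewrite eqn_leq; apply/andP; split.
  by have := @prext_le_free X X set0; rewrite XD0 cards0 addn0 subsetDl; apply.
apply: (@prext_ge X X set0); rewrite ?setU0 ?sub0set ?cards0 ?addn0 //.
by have := rk_mono M (subsetUl X K); lia.
Qed.

End PrincipalExtension.

(** * Relaxation of a circuit-hyperplane *)

(* Elements outside [R] become loops; inside [R], the circuit-hyperplane [W]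
   becomes a basis. *)
Section Relaxation.
Variables (E : finType) (M : matroid E) (R W : {set E}).
Implicit Types X Y : {set E}.
Hypothesis cardW : #|W| = (rk M W).+1.
Hypothesis circuitW : forall x, x \in W -> rk M W <= rk M (W :\ x).
Hypothesis flatW : forall x, x \in R :\: W -> rk M W < rk M (x |: W).
Hypothesis rkR : rk M R <= (rk M W).+1.

Definition relax_rk X := rk M (X :&: R) + (X :&: R == W).

Let rk_proper X : X \proper W -> #|X| <= rk M X.
Proof.
case/properP=> sXW [x xW nxX]; apply: (@indep_sub _ M X (W :\ x)).
  by rewrite subsetD1 sXW.
by have := circuitW xW; have := cardsD1 x W; rewrite xW cardW; lia.
Qed.

Let rk_above X : X \subset R -> W \proper X -> rk M W < rk M X.
Proof.
move=> sXR /properP[sWX [x xX nxW]]; apply: leq_trans (flatW (x := x) _) _.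
  by rewrite inE nxW (subsetP sXR).
by rewrite rk_mono // subUset sub1set xX.
Qed.

Lemma relax_le_card X : relax_rk X <= #|X|.
Proof.
rewrite /relax_rk; apply: leq_trans (subset_leq_card (subsetIl X R)).
by case: eqP => [->|_]; rewrite ?cardW ?addn1 // addn0 rk_le_card.
Qed.

Lemma relax_mono X Y : X \subset Y -> relax_rk X <= relax_rk Y.
Proof.
move=> /(setSI R); rewrite /relax_rk; move: (subsetIr X R) (subsetIr Y R).
move: (X :&: R) (Y :&: R) => {}X {}Y sXR sYR sXY.
have := rk_mono M sXY; have [eqX|_] := eqVneq X W; last by lia.
have [|neqY] := eqVneq Y W; first by lia.
by have := rk_above sYR; rewrite -eqX properEneq sXY eq_sym eqX neqY => /(_ isT); lia.
Qed.

(** The critical cases have [X] and [Y] different from [W]. If their union is [W], both are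
    independent and cardinalities leave room for the extra one. If their intersection is [W], both
    have rank above [rk M W], while the union has rank at most [rk M W + 1]. *)
Lemma relax_submod X Y :
  relax_rk (X :|: Y) + relax_rk (X :&: Y) <= relax_rk X + relax_rk Y.
Proof.
rewrite /relax_rk setIUl setIIl; move: (subsetIr X R) (subsetIr Y R).
move: (X :&: R) (Y :&: R) => {}X {}Y sXR sYR.
have subm := rk_submod M X Y.
have [eqX|neqX] := eqVneq X W.
  have [eqY|neqY] := eqVneq Y W; first by rewrite eqX eqY setUid setIid eqxx.
  case: (boolP (Y \subset W)) => [sYW|nsYW].
    by rewrite eqX (setUidPl sYW) (setIidPr sYW) eqxx (negPf neqY); lia.
  have -> /= : (X :|: Y == W) = false.
    by apply: contraNF nsYW => /eqP <-; apply: subsetUr.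
  by case: (_ == W); lia.
have [eqY|neqY] := eqVneq Y W.
  case: (boolP (X \subset W)) => [sXW|nsXW].
    by rewrite eqY (setUidPr sXW) (setIidPl sXW) eqxx (negPf neqX); lia.
  have -> /= : (X :|: Y == W) = false.
    by apply: contraNF nsXW => /eqP <-; apply: subsetUl.
  by case: (_ == W); lia.
have [eqU|_] := eqVneq (X :|: Y) W.
  have pX : X \proper W by rewrite properEneq neqX -eqU subsetUl.
  have pY : Y \proper W by rewrite properEneq neqY -eqU subsetUr.
  have -> /= : (X :&: Y == W) = false.
    by apply: contraNF neqX => /eqP eqI; rewrite eqEsubset -{2}eqI subsetIl proper_sub.
  have := cardsUI X Y; rewrite eqU in subm *.
  have := rk_le_card M (X :&: Y); move: (rk_proper pX) (rk_proper pY).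
  by rewrite cardW; lia.
have [eqI|_] := eqVneq (X :&: Y) W; last by lia.
have pX : W \proper X by rewrite properEneq eq_sym neqX -eqI subsetIl.
have pY : W \proper Y by rewrite properEneq eq_sym neqY -eqI subsetIr.
have /(rk_mono M) : X :|: Y \subset R by rewrite subUset sXR.
by move: (rk_above sXR pX) (rk_above sYR pY); rewrite eqI; lia.
Qed.

Definition relax := Matroid relax_le_card relax_mono relax_submod.

Lemma relaxE X : rk relax X = rk M (X :&: R) + (X :&: R == W).
Proof. by []. Qed.

End Relaxation.

(** * Enlarging the ground set by loops *)

Section Pullback.
Variables (E E' : finType) (M : matroid E) (f : E -> E').
Hypothesis injf : injective f.
Implicit Types X Y : {set E'}.

Definition pull_rk X := rk M (f @^-1: X).

Lemma pull_le_card X : pull_rk X <= #|X|.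
Proof.
apply: leq_trans (rk_le_card M _) _; rewrite -(card_imset _ injf).
by apply/subset_leq_card/subsetP => _ /imsetP[x + ->]; rewrite inE.
Qed.

Lemma pull_mono X Y : X \subset Y -> pull_rk X <= pull_rk Y.
Proof. by move=> sXY; apply/rk_mono/preimsetS. Qed.

Lemma pull_submod X Y :
  pull_rk (X :|: Y) + pull_rk (X :&: Y) <= pull_rk X + pull_rk Y.
Proof. by rewrite /pull_rk preimsetU preimsetI; apply: rk_submod. Qed.

(* Elements outside the image of [f] are loops. *)
Definition push_matroid := Matroid pull_le_card pull_mono pull_submod.

Lemma push_matroidE X : rk push_matroid X = rk M (f @^-1: X).
Proof. by []. Qed.

End Pullback.

(** * Sets in the augmented ground set *)

Arguments rk : simpl never.

(* The new elements are a copy of ['I_d], [a], [a'] (in the first [bool]) and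
   [b], [b'] (in the second). *)
Definition augmented (E : finType) (d : nat) : finType :=
  Eval hnf in (E + ('I_d + (bool + bool)))%type.

Section Construction.
Variables (E : finType) (d : nat).
Implicit Types X Y : {set E}.
Local Notation G := (augmented E d).

(** The flags follow the order in which the elements are adjoined. [D] is only taken as a whole, so
    inclusions between such sets reduce to inclusions in [E] and boolean implications. *)
Definition aug (X : {set E}) (fD fa fb fa' fb' : bool) : {set G} :=
  [set x | match x with
           | inl y => y \in X
           | inr (inl _) => fD
           | inr (inr (inl z)) => if z then fa' else fa
           | inr (inr (inr z)) => if z then fb' else fb
           end].

Lemma augU X fD fa fb fa' fb' Y gD ga gb ga' gb' :
  aug X fD fa fb fa' fb' :|: aug Y gD ga gb ga' gb' =
  aug (X :|: Y) (fD || gD) (fa || ga) (fb || gb) (fa' || ga') (fb' || gb').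
Proof. by apply/setP => -[x|[z|[[]|[]]]]; rewrite !inE. Qed.

Lemma augI X fD fa fb fa' fb' Y gD ga gb ga' gb' :
  aug X fD fa fb fa' fb' :&: aug Y gD ga gb ga' gb' =
  aug (X :&: Y) (fD && gD) (fa && ga) (fb && gb) (fa' && ga') (fb' && gb').
Proof. by apply/setP => -[x|[z|[[]|[]]]]; rewrite !inE. Qed.

Lemma augC X fD fa fb fa' fb' :
  ~: aug X fD fa fb fa' fb' =
  aug (~: X) (~~ fD) (~~ fa) (~~ fb) (~~ fa') (~~ fb').
Proof. by apply/setP => -[x|[z|[[]|[]]]]; rewrite !inE. Qed.

Lemma augS X fD fa fb fa' fb' Y gD ga gb ga' gb' :
  X \subset Y ->
  [&& fD ==> gD, fa ==> ga, fb ==> gb, fa' ==> ga' & fb' ==> gb'] ->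
  aug X fD fa fb fa' fb' \subset aug Y gD ga gb ga' gb'.
Proof.
move=> /subsetP sXY /and5P[/implyP iD /implyP ia /implyP ib /implyP ia' /implyP ib'].
by apply/subsetP => -[x|[z|[[]|[]]]]; rewrite !inE; auto.
Qed.

Lemma card_aug X fD fa fb fa' fb' :
  #|aug X fD fa fb fa' fb'| = #|X| + fD * d + fa + fb + fa' + fb'.
Proof.
rewrite /aug -sum1dep_card !big_sumType /=.
do 2!rewrite [\sum_(b : bool | _) _]big_mkcond big_bool /=.
rewrite !sum1dep_card cardsE [#|[set _ | fD]|](_ : _ = fD * d).
  by case: fD; case: fa; case: fb; case: fa'; case: fb'; lia.
case: fD; first by rewrite cardsE card_ord mul1n.
by rewrite cardsE card0.
Qed.

Lemma aug_inl X : inl @: X = aug X false false false false false.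
Proof.
have inl_inj : injective (inl : E -> G) by move=> ? ? [].
apply/setP => -[x|y]; rewrite !inE; first by rewrite mem_imset.
suff /negbTE-> : inr y \notin inl @: X by case: y => [|[[]|[]]].
by apply/imsetP => -[].
Qed.

Lemma preim_aug X fD fa fb fa' fb' : inl @^-1: aug X fD fa fb fa' fb' = X.
Proof. by apply/setP => x; rewrite !inE. Qed.

(** * The chain of extensions *)

Variables (M : matroid E) (EE F H C : {set E}) (p : E) (r : nat).
Local Notation Q := (p |: C).
(** [EE] stands for the original ground set inside an extension [M], and [Q] for a basis of the
    common part of the closures of [F] and [H]. Disjointness of the original flats survives as
    [rkeQ]. *)
Hypotheses (sFE : F \subset EE) (sHE : H \subset EE).
Hypotheses (rkEE : rk M EE = r) (rkF : rk M F + d + 1 = r).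
Hypotheses (rkH : rk M H + 1 = r) (rkFH : rk M (F :|: H) = r).
Hypotheses (pC : p \notin C) (cardC : #|C| + 2 = rk M F) (indepQ : #|Q| <= rk M Q).
Hypotheses (rkFQ : rk M (F :|: Q) <= rk M F) (rkHQ : rk M (H :|: Q) <= rk M H).
Hypothesis (rkeQ : forall e, e \in EE -> rk M Q < rk M (e |: Q)).

Let inl_inj : injective (inl : E -> G).
Proof. by move=> ? ? []. Qed.

Let M1 : matroid G := push_matroid M inl_inj.
(* In turn: [D] is generic in [H], [a] and [b] are generic with the rank of
   [EE] raised by one, [a'] is generic in [a |: (Q :|: D)], and [b'] in
   [[set p; b]]. *)
Let M2 : matroid G := prext M1 (aug H false false false false false) 0
                   (aug set0 true false false false false).
Let M3 : matroid G := prext M2 (aug EE false false false false false) 1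
                   (aug set0 false true true false false).
Let M4 : matroid G := prext M3 (aug Q true true false false false) 0
                   (aug set0 false false false true false).
Let M5 : matroid G := prext M4 (aug [set p] false false true false false) 0
                   (aug set0 false false false false true).
(** [R] leaves out [p], which lies in the closure of [W]: with [p] present, [W] would not be a
    flat. *)
Let R := aug (EE :|: C) true true true true true.
Let W := aug C true true true true true.

(** * Rank bounds at each stage of the chain *)

Let rk1 X fD fa fb fa' fb' : rk M1 (aug X fD fa fb fa' fb') = rk M X.
Proof. by rewrite push_matroidE preim_aug. Qed.

Let old2 X fa fb fa' fb' :
  rk M2 (aug X false fa fb fa' fb') = rk M1 (aug X false fa fb fa' fb').
Proof. by apply: prext_old; rewrite augC setC0; apply: augS; rewrite ?subsetT ?implybT.
Qed.

Let old3 X fD fa' fb' :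
  rk M3 (aug X fD false false fa' fb') = rk M2 (aug X fD false false fa' fb').
Proof. by apply: prext_old; rewrite augC setC0; apply: augS; rewrite ?subsetT ?implybT.
Qed.

Let old4 X fD fa fb fb' :
  rk M4 (aug X fD fa fb false fb') = rk M3 (aug X fD fa fb false fb').
Proof. by apply: prext_old; rewrite augC setC0; apply: augS; rewrite ?subsetT ?implybT.
Qed.

Let old5 X fD fa fb fa' :
  rk M5 (aug X fD fa fb fa' false) = rk M4 (aug X fD fa fb fa' false).
Proof. by apply: prext_old; rewrite augC setC0; apply: augS; rewrite ?subsetT ?implybT.
Qed.

Let cardQ : #|Q| = #|C| + 1.
Proof. by rewrite cardsU1 pC; lia. Qed.

Let rk2_ge X n : n <= rk M X + d -> n <= rk M (X :|: H) ->
  n <= rk M2 (aug X true false false false false).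
Proof.
move=> n1 n2; apply: (@prext_ge _ _ _ _ _ _ (aug X false false false false false)
  (aug set0 true false false false false)); rewrite ?augU ?augC ?setC0 ?setU0.
- exact: augS.
- by apply: augS => //; apply: subsetT.
- exact: augS.
- by rewrite rk1 card_aug cards0 /=; lia.
- by rewrite rk1 addn0.
Qed.

Let rk3_ge X (fD fa fb : bool) n : n <= rk M2 (aug X fD false false false false) + (fa + fb) ->
  n <= rk M2 (aug (X :|: EE) fD false false false false) + 1 ->
  n <= rk M3 (aug X fD fa fb false false).
Proof.
move=> n1 n2; apply: (@prext_ge _ _ _ _ _ _ (aug X fD false false false false)
  (aug set0 false fa fb false false)); rewrite ?augU ?augC ?setC0 ?setU0.
- by apply: augS; rewrite //= !orbF !implybb.
- by apply: augS; rewrite ?subsetT ?implybT.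
- by apply: augS; rewrite ?implybT.
- by rewrite card_aug cards0 /=; lia.
- by rewrite !orbF.
Qed.

Let rk2_EE X fD : EE \subset X -> r <= rk M2 (aug X fD false false false false).
Proof.
move=> sEX; rewrite -rkEE -(rk1 EE false false false false false) -old2.
by apply: rk_mono; apply: augS.
Qed.

(** The set has [#|Q| + d + 2 = r] elements, so this bound makes it independent. *)
Let rk3_Qab : r <= rk M3 (aug Q true true true false false).
Proof.
apply: rk3_ge; last by have := rk2_EE true (subsetUr Q EE); lia.
suff : r - 2 <= rk M2 (aug Q true false false false false) by lia.
have := rk_mono M (subsetUr Q H).
by move=> ?; apply: rk2_ge; lia.
Qed.

Let indep3 (X : {set G}) : X \subset aug Q true true true false false -> #|X| <= rk M3 X.
Proof.
move=> sX; apply: indep_sub sX _; rewrite card_aug /=; have := rk3_Qab.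
by lia.
Qed.

Let indep3_aug X (fD fa fb : bool) : X \subset Q ->
  #|X| + fD * d + fa + fb <= rk M3 (aug X fD fa fb false false).
Proof.
move=> sX; apply: leq_trans (indep3 _); first by rewrite card_aug /=; lia.
by apply: augS; rewrite ?implybT.
Qed.

(** As [e] is outside the closure of [Q], the set [e |: Q] has rank [r - 1] or more together with
    [D]; then [a] and [b] add two, up to the cap, which is at least [r + 1]. *)
Let rk3_eQab e : e \in EE -> r < rk M3 (aug (e |: Q) true true true false false).
Proof.
move=> eE; apply: rk3_ge; last by have := rk2_EE true (subsetUr (e |: Q) EE); lia.
suff : r - 1 <= rk M2 (aug (e |: Q) true false false false false) by lia.
have := rk_mono M (subsetUr (e |: Q) H); have := rkeQ eE.
by move=> ? ?; apply: rk2_ge; lia.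
Qed.

Let rk4_ge (Y : {set G}) n : Y \subset aug setT true true true false true ->
  n <= rk M3 Y + 1 -> n <= rk M3 (Y :|: aug Q true true false false false) ->
  n <= rk M4 (Y :|: aug set0 false false false true false).
Proof.
move=> sY n1 n2; apply: (prext_ge (subxx _)); rewrite ?augC ?setC0 ?addn0 //.
by rewrite card_aug cards0.
Qed.

Let rk5_ge (Y : {set G}) n : Y \subset aug setT true true true true false ->
  n <= rk M4 Y + 1 -> n <= rk M4 (Y :|: aug [set p] false false true false false) ->
  n <= rk M5 (Y :|: aug set0 false false false false true).
Proof.
move=> sY n1 n2; apply: (prext_ge (subxx _)); rewrite ?augC ?setC0 ?addn0 //.
by rewrite card_aug cards0.
Qed.

Let rk2_le_free X fD : rk M2 (aug X fD false false false false) <= rk M X + d.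
Proof.
rewrite -(rk1 X false false false false false).
have cardD : #|aug set0 true false false false false| = d.
  by rewrite card_aug cards0 /=; lia.
rewrite -[X in _ + X]cardD.
by apply: prext_le_free; rewrite ?setDE ?augC ?augI; apply: augS;
  rewrite ?subsetIl ?subsetIr //= ?andbT ?andbF ?implybT ?implybb.
Qed.

Let rk2_le_cap X fD : rk M2 (aug X fD false false false false) <= rk M (X :|: H).
Proof.
rewrite -(rk1 (X :|: H) false false false false false) -[leqRHS]addn0.
by apply: prext_le_cap; rewrite setDE augC augI augU setC0 setIT; apply: augS;
  rewrite //= ?andbF.
Qed.

Let rk3_le_free X fD (fa fb : bool) :
  rk M3 (aug X fD fa fb false false) <= rk M2 (aug X fD false false false false) + (fa + fb).
Proof.
have -> : fa + fb = #|aug set0 false fa fb false false|.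
  by rewrite card_aug cards0 /=; lia.
by apply: prext_le_free; rewrite ?setDE ?augC ?augI; apply: augS;
  rewrite ?subsetIl ?subsetIr //= ?andbT ?andbF ?implybT ?implybb.
Qed.

Let rk3_le_cap X fD (fa fb : bool) :
  rk M3 (aug X fD fa fb false false) <= rk M2 (aug (X :|: EE) fD false false false false) + 1.
Proof.
by apply: prext_le_cap; rewrite setDE augC augI augU setC0 setIT; apply: augS;
  rewrite //= ?andbT ?andbF ?orbF ?implybb.
Qed.

(** Upper bounds replace a new element by a set that spans it: [a'] by [Q], [D] and [a], and in
    [rk5_le] likewise [b'] by [p] and [b]. *)
Let rk4_le X fD fa fb fa' :
  rk M4 (aug X fD fa fb fa' false) <= rk M3 (aug (X :|: Q) true true fb false false).
Proof.
rewrite -[leqRHS]addn0; apply: prext_le_cap; rewrite setDE augC augI augU setC0 setIT.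
by apply: augS; rewrite //= ?andbT ?andbF ?orbF ?implybb ?implybT.
Qed.

Let rk5_le X fD fa fb fa' fb' :
  rk M5 (aug X fD fa fb fa' fb') <= rk M4 (aug (p |: X) fD fa true fa' false).
Proof.
rewrite -[leqRHS]addn0 setUC; apply: prext_le_cap; rewrite setDE augC augI augU setC0 setIT.
by apply: augS; rewrite //= ?andbT ?andbF ?orbF ?implybb ?implybT.
Qed.

(** * [W] is a circuit-hyperplane *)

Let rk4_Cab : r <= rk M4 (aug C true true true true false).
Proof.
have -> : aug C true true true true false =
    aug C true true true false false :|: aug set0 false false false true false.
  by rewrite augU setU0.
apply: rk4_ge; first by apply: augS; rewrite ?subsetT.
  by have := @indep3_aug C true true true (subsetUr _ _); lia.
apply: leq_trans rk3_Qab (rk_mono _ _); rewrite augU.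
by apply: augS; rewrite ?subsetUr.
Qed.

(** [W] is spanned by [Q], [D], [a] and [b], a set of [r] elements. *)
Let rk5_W : rk M5 W <= r.
Proof.
apply: leq_trans (rk5_le _ _ _ _ _ _) (leq_trans (rk4_le _ _ _ _ _) _).
by apply: leq_trans (rk_le_card _ _) _; rewrite setUid card_aug; lia.
Qed.

(** Here [Y] is independent with [r - 2] elements, and each of [a'] and [b'] adds one to its rank.
    The caps do not interfere: [Y] together with [Q], [D] and [a] has rank at least [r], and [b']
    comes with [p], which makes up for [x]. *)
Let rk5_W_generic x : x \in aug C true true false false false -> r <= rk M5 (W :\ x).
Proof.
move=> xZ; pose Y := aug C true true true false false :\ x.
have sYQ : Y \subset aug Q true true true false false.
  by apply: subset_trans (subsetDl _ _) _; apply: augS; rewrite ?subsetUr.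
have sZ : aug C true true false false false \subset aug C true true true false false.
  exact: augS.
have cardY : #|Y| + 2 = r.
  have := cardsD1 x (aug C true true true false false).
  by rewrite -/Y card_aug (subsetP sZ _ xZ) /=; lia.
have pY : inl p \notin Y by rewrite !inE (negPf pC) andbF.
have sQY : aug Q true true true false false \subset Y :|: aug Q true true false false false.
  apply/subsetP => -[y|[z|[[]|[]]]]; rewrite !inE ?orbT ?orbF ?andbT //=.
    by move=> ->; rewrite orbT.
  by move=> _; apply: contraTneq xZ => <-; rewrite inE.
have sY : Y \subset aug setT true true true false true.
  by apply: subset_trans sYQ _; apply: augS; rewrite ?subsetT.
apply: leq_trans (_ : _ <= rk M5 (Y :|: aug set0 false false false true false
                             :|: aug set0 false false false false true)) _; last first.
  apply/rk_mono/subsetP => g; rewrite !inE.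
  case/orP=> [/orP[/andP[-> gZ]|ga]|gb].
  - by move: gZ; case: g => [y|[z|[[]|[]]]].
  - have -> : g != x.
      by apply: contraTneq xZ => <-;
        move: ga; case: g => [y|[z|[[]|[]]]]; rewrite !inE.
    by move: ga; case: g => [y|[z|[[]|[]]]] //; rewrite inE.
  - have -> : g != x.
      by apply: contraTneq xZ => <-;
        move: gb; case: g => [y|[z|[[]|[]]]]; rewrite !inE.
    by move: gb; case: g => [y|[z|[[]|[]]]] //; rewrite inE.
apply: rk5_ge.
- rewrite subUset (subset_trans (subsetDl _ _)) /=; first by apply: augS; rewrite ?subsetT.
  by apply: augS; rewrite ?subsetT.
- suff : r - 1 <= rk M4 (Y :|: aug set0 false false false true false) by lia.
  apply: rk4_ge => //; first by have := indep3 sYQ; lia.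
  by have := rk_mono M3 sQY; have := rk3_Qab; lia.
rewrite setUAC; apply: rk4_ge.
- by rewrite subUset sY; apply: augS; rewrite ?subsetT.
- have spY : inl p |: Y \subset aug Q true true true false false.
    by rewrite subUset sYQ sub1set !inE eqxx.
  have /(rk_mono M3) : inl p |: Y \subset Y :|: aug [set p] false false true false false.
    by rewrite subUset subsetUl sub1set !inE eqxx orbT.
  by have := indep3 spY; rewrite cardsU1 pY; lia.
apply: leq_trans rk3_Qab (rk_mono _ _); apply: subset_trans sQY _.
by apply: setSU; apply: subsetUl.
Qed.

Let circuitW x : x \in W -> r <= rk M5 (W :\ x).
Proof.
have [xZ|] := boolP (x \in aug C true true false false false).
  by move=> _; apply: rk5_W_generic.
case: x => [x|[z|[[]|[]]]]; rewrite !inE //; first by move/negP.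
(* The elements left to delete are [a'], [b'] and [b], in this order. *)
- move=> _ _; apply: leq_trans (_ : r <= rk M5 (aug C true true true false true)) _; last first.
    by apply/rk_mono/subsetP => -[y|[z|[[]|[]]]]; rewrite !inE.
  have -> : aug C true true true false true =
      aug C true true true false false :|: aug set0 false false false false true.
    by rewrite augU setU0.
  apply: rk5_ge; first by apply: augS; rewrite ?subsetT.
    by rewrite old4; have := @indep3_aug C true true true (subsetUr _ _); lia.
  by rewrite augU setUC old4; apply: rk3_Qab.
- move=> _ _; apply: leq_trans (_ : r <= rk M5 (aug C true true true true false)) _.
    by rewrite old5; apply: rk4_Cab.
  by apply/rk_mono/subsetP => -[y|[z|[[]|[]]]]; rewrite !inE.
move=> _ _; apply: leq_trans (_ : r <= rk M5 (aug C true true false true true)) _; last first.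
  by apply/rk_mono/subsetP => -[y|[z|[[]|[]]]]; rewrite !inE.
have -> : aug C true true false true true =
    aug C true true false true false :|: aug set0 false false false false true.
  by rewrite augU setU0.
apply: rk5_ge; first by apply: augS; rewrite ?subsetT.
  have -> : aug C true true false true false =
      aug C true true false false false :|: aug set0 false false false true false.
    by rewrite augU setU0.
  suff : r - 1 <= rk M4 (aug C true true false false false
                         :|: aug set0 false false false true false) by lia.
  apply: rk4_ge; first by apply: augS; rewrite ?subsetT.
    by have := @indep3_aug C true true false (subsetUr _ _); lia.
  have := @indep3_aug Q true true false (subxx _).
  by rewrite augU setUCA setUid /=; lia.
rewrite augU; apply: leq_trans rk3_Qab _; rewrite -old4; apply: rk_mono.
by apply: augS; rewrite // setUC.
Qed.

Let rk5_WE : rk M5 W = r.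
Proof.
apply/eqP; rewrite eqn_leq rk5_W.
apply: leq_trans (@circuitW (inr (inr (inl false))) _) (rk_mono _ (subsetDl _ _)).
by rewrite inE.
Qed.

Let cardW : #|W| = (rk M5 W).+1.
Proof. by rewrite rk5_WE card_aug /=; lia. Qed.

Let circuitW' x : x \in W -> rk M5 W <= rk M5 (W :\ x).
Proof. by rewrite rk5_WE; apply: circuitW. Qed.

(** Only an element [e] of [EE] can occur. The cap for [b'] brings in [p], and [e |: Q] with [D],
    [a], [b] already exceeds rank [r]. *)
Let flatW x : x \in R :\: W -> rk M5 W < rk M5 (x |: W).
Proof.
rewrite rk5_WE; case: x => [e|[z|[[]|[]]]]; rewrite !inE // => /andP[/negPf->].
rewrite orbF => eE.
have -> : inl e |: W = aug (e |: C) true true true true false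
                       :|: aug set0 false false false false true.
  by rewrite augU setU0 /=; apply/setP => -[y|[z|[[]|[]]]]; rewrite !inE.
apply: rk5_ge; first by apply: augS; rewrite ?subsetT.
  rewrite addn1 ltnS; apply: leq_trans rk4_Cab (rk_mono _ _).
  by apply: augS; rewrite ?subsetUr.
apply: leq_trans (rk3_eQab eE) _; rewrite -old4; apply: rk_mono.
by rewrite augU setUAC -setUA; apply: augS.
Qed.

Let rkEEQ : rk M (EE :|: Q) <= r.
Proof.
have := rk_submod M EE (F :|: Q); rewrite setUA (setUidPl sFE).
have /(rk_mono M) : F \subset EE :&: (F :|: Q) by rewrite subsetI sFE subsetUl.
by lia.
Qed.

(** The cap in [M3] lets [a] and [b] together raise the rank of [EE] by only one, and [a'], [b'] are
    spanned by the rest together with [p]. *)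
Let rkR : rk M5 R <= (rk M5 W).+1.
Proof.
rewrite rk5_WE; apply: leq_trans (rk5_le _ _ _ _ _ _) (leq_trans (rk4_le _ _ _ _ _) _).
apply: leq_trans (rk3_le_cap _ _ _ _) _; rewrite addn1 ltnS.
apply: leq_trans (rk2_le_cap _ _) (leq_trans (rk_mono _ _) rkEEQ).
have sE := subsetUl EE Q; have := subsetUr EE Q; rewrite subUset => /andP[sp sC].
by rewrite !subUset sp sC sE (subset_trans sHE sE).
Qed.

(** * The relaxed matroid *)

Let N : matroid G := relax cardW circuitW' flatW rkR.

(** [W] contains both [a] and [b], so without one of them no rank is gained by relaxing. *)
Let N_le X fD fa fb fa' fb' : ~~ (fa && fb) ->
  rk N (aug X fD fa fb fa' fb') <= rk M5 (aug X fD fa fb fa' fb').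
Proof.
move=> nab; rewrite !relaxE.
have -> : (aug X fD fa fb fa' fb' :&: R == W) = false.
  apply: contraNF nab => /eqP eqW.
  have : inr (inr (inl false)) \in W by rewrite inE.
  have : inr (inr (inr false)) \in W by rewrite inE.
  by rewrite -eqW !inE !andbT => -> ->.
by rewrite addn0 rk_mono // subsetIl.
Qed.

Let N_ge X fD fa fb fa' fb' : X \subset EE :|: C ->
  rk M5 (aug X fD fa fb fa' fb') <= rk N (aug X fD fa fb fa' fb').
Proof.
move=> sX; rewrite !relaxE (setIidPl _) ?leq_addr //.
by apply: augS; rewrite ?implybT.
Qed.

Let old1 X : rk M5 (aug X false false false false false) = rk M X.
Proof. by rewrite old5 old4 old3 old2 rk1. Qed.

(** Over [F], the set [D] costs [d] and one of [a], [b] costs one, in total [rk F + d + 1 = r]. Over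
    [H], which spans [D], the total in [rk3_HQ] is [rk H + 1 = r]. *)
Let rk3_FQ (fa fb : bool) : fa + fb <= 1 ->
  rk M3 (aug (F :|: Q) true fa fb false false) <= r.
Proof.
move=> ab; apply: leq_trans (rk3_le_free _ _ _ _) _.
by have := rk2_le_free (F :|: Q) true; lia.
Qed.

Let rk3_HQ (fa fb : bool) : fa + fb <= 1 ->
  rk M3 (aug (H :|: Q) true fa fb false false) <= r.
Proof.
move=> ab; apply: leq_trans (rk3_le_free _ _ _ _) _.
by have := rk2_le_cap (H :|: Q) true; rewrite setUAC setUid; lia.
Qed.

Let N_FHa (fa fb fa' fb' : bool) : fa || fb ->
  r < rk N (aug (F :|: H) false fa fb fa' fb').
Proof.
move=> ab; have sFH : F :|: H \subset EE by rewrite subUset sFE.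
apply: leq_trans (N_ge _ _ _ _ _ (subset_trans sFH (subsetUl _ _))).
apply: leq_trans (_ : r < rk M5 (aug (F :|: H) false fa fb false false)) _; last first.
  by apply: rk_mono; apply: augS; rewrite ?implybb.
rewrite old5 old4; apply: rk3_ge.
  by rewrite old2 rk1 rkFH; move: ab; case: fa; case: fb => //= _; lia.
by have := rk2_EE false (subsetUr (F :|: H) EE); lia.
Qed.

(** Only the restriction of [M] to [EE] is extended, since [p] is a loop of [N]. *)
Lemma not_modular_ext : exists2 N : matroid G,
  forall X, X \subset EE -> rk N (inl @: X) = rk M X &
  forall (E2 : finType) (N' : matroid E2) (j : G -> E2), extension N N' j ->
  ~ modular_pair N' (cl N' (j @: (inl @: F))) (cl N' (j @: (inl @: H))).
Proof.
exists N => [X sX|E2 N' j [_ rkN']].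
  have sXR : X \subset EE :|: C := subset_trans sX (subsetUl _ _).
  rewrite aug_inl; apply/eqP; rewrite -[X in _ == X]old1 eqn_leq.
  by rewrite N_le // N_ge.
have oldN X : X \subset EE :|: C -> rk N (aug X false false false false false) = rk M X.
  by move=> sX; apply/eqP; rewrite -[X in _ == X]old1 eqn_leq N_le // N_ge.
have sF := subset_trans sFE (subsetUl EE C); have sH := subset_trans sHE (subsetUl EE C).
have sFC : F :|: C \subset EE :|: C by apply: setSU.
have sHC : H :|: C \subset EE :|: C by apply: setSU.
have sFH : F :|: H \subset EE :|: C by rewrite subUset sF.
have subQ X : X :|: C \subset X :|: Q by rewrite setUS ?subsetUr.
have sub_pQ X : p |: X \subset X :|: Q by rewrite setUC setUS ?subsetUl.
rewrite !aug_inl.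
apply: (@not_modular_cl _ _ _ _ (j @: aug C false false false false false)
  (j @: aug set0 true false false false false)
  (j @: aug set0 false true false true false)
  (j @: aug set0 false false true false true) d r);
  rewrite -?imsetU ?augU ?setU0 ?set0U /= ?rkN' ?oldN //.
- by rewrite rkFH.
- by have := rk_mono M (subQ F); lia.
- by have := rk_mono M (subQ H); lia.
- apply: leq_trans (N_ge _ _ _ _ _ sF); rewrite old5 old4 old3.
  by apply: rk2_ge; lia.
- apply: leq_trans (@N_le F true true false true false isT) _; rewrite old5.
  by apply: leq_trans (rk4_le _ _ _ _ _) (@rk3_FQ true false isT).
- apply: leq_trans (@N_le H true true false true false isT) _; rewrite old5.
  by apply: leq_trans (rk4_le _ _ _ _ _) (@rk3_HQ true false isT).
- exact: N_FHa.
- apply: leq_trans (@N_le F true false true false true isT) (leq_trans (rk5_le _ _ _ _ _ _) _).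
  rewrite old4; apply: leq_trans (rk_mono _ _) (@rk3_FQ false true isT).
  by apply: augS; first exact: sub_pQ.
- apply: leq_trans (@N_le H true false true false true isT) (leq_trans (rk5_le _ _ _ _ _ _) _).
  rewrite old4; apply: leq_trans (rk_mono _ _) (@rk3_HQ false true isT).
  by apply: augS; first exact: sub_pQ.
- exact: N_FHa.
(* The relaxation gives [W] rank [r + 1]. *)
rewrite relaxE (setIidPl _) ?eqxx ?rk5_WE ?addn1 //.
by apply: augS; rewrite ?subsetUr.
Qed.

End Construction.

(** * From the given flats to the construction *)

Theorem theorem8 (E : finType) (M : matroid E) (F H : {set E})
    (flatF : flat M F) (hypH : hyperplane M H)
    (disjFH : [disjoint F & H]) (nmodFH : ~ modular_pair M F H) :
  exists (E1 : finType) (N : matroid E1) (i : E -> E1),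
    extension M N i /\
    forall (E2 : finType) (N' : matroid E2) (j : E1 -> E2),
      extension N N' j ->
      ~ modular_pair N' (cl N' (j @: (i @: F))) (cl N' (j @: (i @: H))).
Proof.
have [[E1 [M1 [i [[inji rki] modM1]]]]|nomod] := classic
    (exists (E1 : finType) (M1 : matroid E1) (i : E -> E1),
       extension M M1 i /\ modular_pair M1 (cl M1 (i @: F)) (cl M1 (i @: H))); last first.
  exists E, M, id; split.
    by split=> [|X]; [apply: inj_id | rewrite imset_id].
  by move=> E2 N' j extj; rewrite !imset_id => modN'; case: nomod; exists E2, N', j.
have FH0 : F :&: H = set0 by apply/eqP; rewrite setI_eq0.
case/andP: hypH => flatH /eqP rkH.
have clF e : rk M (e |: F) = rk M F -> e \in F.
  by move=> eF; rewrite -(eqP flatF) inE eF.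
have clH e : rk M (e |: H) = rk M H -> e \in H.
  by move=> eH; rewrite -(eqP flatH) inE eH.
have rkFH_lt : rk M (F :|: H) < rk M F + rk M H.
  rewrite ltn_neqAle; have := rk_submod M F H; rewrite FH0 rk0 addn0 => ->.
  by rewrite andbT; apply/eqP => eqFH; apply: nmodFH; rewrite /modular_pair FH0 rk0 addn0.
(* If [F] were inside [H], disjointness would make it empty and the pair modular. *)
have [f fF nfH] : exists2 f, f \in F & f \notin H.
  apply/subsetPn/negP => sFH; have F0 : F = set0 by rewrite -(setIidPl sFH).
  by move: rkFH_lt; rewrite (setUidPr sFH) F0 rk0 add0n ltnn.
have rkFH : rk M (F :|: H) = rk M [set: E].
  apply/eqP; rewrite eqn_leq rk_mono ?subsetT //= -rkH.
  apply: leq_trans (_ : rk M (f |: H) <= _); last first.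
    by rewrite rk_mono // setSU // sub1set.
  rewrite ltn_neqAle rk_mono ?subsetUr // andbT.
  by apply: contra nfH => /eqP/esym/clH.
(* A flat of full rank is the whole ground set; then [H] would be empty and the pair modular. *)
have rkF : rk M F < rk M [set: E].
  rewrite ltn_neqAle rk_mono ?subsetT // andbT; apply: contraTN isT => /eqP eqF.
  have FT : F = [set: E].
    apply/setP => e; rewrite inE; apply: clF; apply/eqP.
    by rewrite eqn_leq {1}eqF !rk_mono ?subsetT ?subsetUr.
  by move: rkFH_lt; move: FH0 rkH; rewrite FT setTI => ->; rewrite setU0 rk0; lia.
pose L := cl M1 (i @: F) :&: cl M1 (i @: H).
have rkL : rk M1 L + 1 = rk M F.
  move: modM1; rewrite /modular_pair -/L rk_clUcl !rk_cl -imsetU !rki rkFH; lia.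
have [B sBL [cardB rkB]] := exists_basis M1 L.
(* Non-modularity forces [rk M F >= 2], so [B], of size [rk M F - 1], is nonempty. *)
have [p pB] : exists p, p \in B by apply/card_gt0P; lia.
have /andP[sBF sBH] : (B \subset cl M1 (i @: F)) && (B \subset cl M1 (i @: H)).
  by rewrite -subsetI.
have eclB (X : {set E}) e : B \subset cl M1 (i @: X) -> rk M1 (i e |: B) <= rk M1 B ->
    rk M (e |: X) = rk M X.
  rewrite setUC -sub_clE sub1set => sB /(subsetP (cl_min sB)).
  by rewrite inE -imsetU1 !rki => /eqP.
(* An original element in the closure of [B] would lie in both flats, which are disjoint. *)
have rkeB e : e \in i @: [set: E] -> rk M1 B < rk M1 (e |: B).
  case/imsetP=> e0 _ ->; rewrite ltnNge; apply/negP => leB.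
  have : e0 \in F :&: H by rewrite inE (clF _ (eclB _ _ sBF leB)) (clH _ (eclB _ _ sBH leB)).
  by rewrite FH0 inE.
have BE : p |: B :\ p = B by apply: setD1K.
have cardBp := cardsD1 p B; rewrite pB in cardBp.
(* By [rkF], the subtraction that defines [d] is not truncated. *)
have [||||||||||||N rkN nmodN] := @not_modular_ext E1 (rk M [set: E] - rk M F - 1) M1
  (i @: [set: E]) (i @: F) (i @: H) (B :\ p) p (rk M [set: E]);
  rewrite ?BE -?imsetU ?rki ?imsetS ?subsetT ?rkFH //.
- lia.
- lia.
- by rewrite !inE eqxx.
- lia.
- by rewrite cardB rkB.
- by rewrite -(rki F) -sub_clE.
- by rewrite -(rki H) -sub_clE.
exists (augmented E1 (rk M [set: E] - rk M F - 1)), N, (fun e => inl (i e)).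
have comp (X : {set E}) : [set (inl (i e) : augmented _ _) | e in X] = inl @: (i @: X).
  by rewrite -imset_comp.
split; first split=> [x y [/inji]|X] //.
  by rewrite comp rkN ?rki // imsetS ?subsetT.
by move=> E2 N' j extj; rewrite !comp; apply: nmodN.
Qed.
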